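(* For $\theta\in[0,2\pi]$ write $\widehat c=\cos\frac\theta2$, $\widehat s=\sin\frac\theta2$; for $\beta\in\mathbf{R}$ write $\widehat{ch}=\cosh\frac\beta2$, $\widehat{sh}=\sinh\frac\beta2$. Let $R_{i,j}$ be the $5\times5$ standard Givens matrices with angle $\theta$ and $H_{i,j}$ the $5\times 5$ hyperbolic Givens matrices with parameter $\beta$. Then the preimages under $\Phi_{3,2}:\mathrm{Spin}^{+}(3,2)\to SO^{+}(3,2)$, with $\mathrm{Spin}^{+}(3,2)\subset M(4,\mathbf{R})$, are $$\Phi_{3,2}^{-1}(R_{1,2})=\left\{\pm\begin{pmatrix} \widehat c & 0 & 0 & \widehat s \\ 0 & \widehat c & \widehat s & 0 \\ 0 & -\widehat s & \widehat c & 0 \\ -\widehat s & 0 & 0 & \widehat c \end{pmatrix}\right\},\quad \Phi_{3,2}^{-1}(R_{1,3})=\left\{\pm\begin{pmatrix} \widehat c & 0 & \widehat s & 0 \\ 0 & \widehat c & 0 & -\widehat s \\ -\widehat s & 0 & \widehat c & 0 \\ 0 & \widehat s & 0 & \widehat c \end{pmatrix}\right\},$$ $$\Phi_{3,2}^{-1}(R_{2,3})=\left\{\pm\begin{pmatrix} \widehat c & \widehat s & 0 & 0 \\ -\widehat s & \widehat c & 0 & 0 \\ 0 & 0 & \widehat c & \widehat s \\ 0 & 0 & -\widehat s & \widehat c \end{pmatrix}\right\},\quad \Phi_{3,2}^{-1}(R_{4,5})=\left\{\pm\begin{pmatrix} \widehat c & 0 & 0 & -\widehat s \\ 0 & \widehat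 c & \widehat s & 0 \\ 0 & -\widehat s & \widehat c & 0 \\ \widehat s & 0 & 0 & \widehat c \end{pmatrix}\right\},$$ $$\Phi_{3,2}^{-1}(H_{1,4})=\{\pm\mathrm{diag}(e^{\beta/2},e^{\beta/2},e^{-\beta/2},e^{-\beta/2})\},\quad \Phi_{3,2}^{-1}(H_{2,5})=\{\pm\mathrm{diag}(e^{\beta/2},e^{-\beta/2},e^{\beta/2},e^{-\beta/2})\},$$ $$\Phi_{3,2}^{-1}(H_{3,4})=\left\{\pm\begin{pmatrix} \widehat{ch} & 0 & -\widehat{sh} & 0 \\ 0 & \widehat{ch} & 0 & \widehat{sh} \\ -\widehat{sh} & 0 & \widehat{ch} & 0 \\ 0 & \widehat{sh} & 0 & \widehat{ch} \end{pmatrix}\right\}.$$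
   Context: Let $\sigma_x=\begin{pmatrix} 0 & 1 \\ 1 & 0 \end{pmatrix}$, $i\sigma_y=\begin{pmatrix} 0 & 1 \\ -1 & 0 \end{pmatrix}$, $\sigma_z=\mathrm{diag}(1,-1)$. The basis of one-vectors of $\mathrm{Cl}(3,2)$ (inside $M(8,\mathbf{R})$) is $X_1=\sigma_x\otimes I_4$, $X_2=\sigma_z\otimes\sigma_x\otimes I_2$, $X_3=\sigma_z\otimes\sigma_z\otimes\sigma_z$, $X_4=(i\sigma_y)\otimes I_4$, $X_5=\sigma_z\otimes(i\sigma_y)\otimes I_2$ (Kronecker products). $\mathrm{Spin}^{+}(3,2)=\{Y\in M(4,\mathbf{R}):Y^TMY=M\}$ with $M=\begin{pmatrix} 0_2 & J_2 \\ J_2 & 0_2 \end{pmatrix}$, $J_2=\begin{pmatrix} 0 & 1 \\ -1 & 0 \end{pmatrix}$. It is embedded in $M(8,\mathbf{R})$ by $Y\mapsto\hat Y$, where $\hat Y_{2i-1,2j-1}=Y_{ij}$, $\hat Y_{2i,2j}=\delta_i\delta_jY_{ij}$ with $(\delta_1,\delta_2,\delta_3,\delta_4)=(1,-1,-1,1)$, $1\le i,j\le 4$, and all other entries of $\hat Y$ are $0$. $\Phi_{3,2}(Y)$ is the $5\times5$ matrix of the linear map $V\mapsto\hat YV\hat Y^{-1}$ on $\mathrm{span}_{\mathbf{R}}\{X_1,\dots,X_5\}$ with respect to this ordered basis (column $j$ holds the coordinates of $\hat YX_j\hat Y^{-1}$). $SO^{+}(3,2)$ is the identity component of $\{X\in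 M(5,\mathbf{R}):X^TI_{3,2}X=I_{3,2},\det X=1\}$, $I_{3,2}=\mathrm{diag}(1,1,1,-1,-1)$. $R_{i,j}$ is the identity except in the principal submatrix on rows and columns $(i,j)$, where it is $\begin{pmatrix} \cos\theta & -\sin\theta \\ \sin\theta & \cos\theta \end{pmatrix}$; $H_{i,j}$ is the identity except in the principal submatrix on rows and columns $(i,j)$, where it is $\begin{pmatrix} \cosh\beta & \sinh\beta \\ \sinh\beta & \cosh\beta \end{pmatrix}$. *)

(* Defs.v *)
From mathcomp Require Import all_boot all_order all_algebra.
From mathcomp Require Import mxtens.
From mathcomp Require Import all_classical all_reals all_analysis.

Set Implicit Arguments.
Unset Strict Implicit.
Unset Printing Implicit Defensive.

Import Order.TTheory GRing.Theory Num.Theory.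
Import numFieldNormedType.Exports.

Local Open Scope classical_set_scope.
Local Open Scope ring_scope.

Section Definitions.
Context {R : realType}.
Implicit Types (x t b : R).

Definition cosh x : R := (expR x + expR (- x)) / 2.
Definition sinh x : R := (expR x - expR (- x)) / 2.

Definition mx_of_rows m n (rows : seq (seq R)) : 'M[R]_(m, n) :=
  \matrix_(i, j) (nth [::] rows i)`_j.

Definition mx_of_diag n (d : seq R) : 'M[R]_n := diag_mx (\row_j d`_j).

(* The identity, except in the principal submatrix on rows and columns (p, q),
   where it is (a b; c d).  The positions p and q are counted from 1. *)
Definition plane_mx n (p q : nat) (a b c d : R) : 'M[R]_n :=
  \matrix_(i, j)
    if (i.+1 == p) && (j.+1 == p) then a else
    if (i.+1 == p) && (j.+1 == q) then b else
    if (i.+1 == q) && (j.+1 == p) then c else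
    if (i.+1 == q) && (j.+1 == q) then d else (i == j)%:R.

Definition givens (p q : nat) t : 'M[R]_5 :=
  plane_mx 5 p q (cos t) (- sin t) (sin t) (cos t).

Definition hgivens (p q : nat) b : 'M[R]_5 :=
  plane_mx 5 p q (cosh b) (sinh b) (sinh b) (cosh b).

Definition sigma_x : 'M[R]_2 := mx_of_rows 2 2 [:: [:: 0; 1]; [:: 1; 0]].
(* i * sigma_y, which is real and also serves as J_2 *)
Definition isigma_y : 'M[R]_2 := mx_of_rows 2 2 [:: [:: 0; 1]; [:: -1; 0]].
Definition sigma_z : 'M[R]_2 := mx_of_diag 2 [:: 1; -1].

Definition one_vectors : 5.-tuple 'M[R]_8 :=
  [tuple sigma_x *t (1%:M : 'M[R]_4);
         sigma_z *t sigma_x *t (1%:M : 'M[R]_2);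
         sigma_z *t sigma_z *t sigma_z;
         isigma_y *t (1%:M : 'M[R]_4);
         sigma_z *t isigma_y *t (1%:M : 'M[R]_2)].

Definition spin_form : 'M[R]_(2 + 2) := block_mx 0 isigma_y isigma_y 0.

Definition Spin32 : set 'M[R]_4 :=
  [set Y | Y^T *m spin_form *m Y = spin_form].

Definition hat_sign (i : 'I_4) : R := [:: 1; -1; -1; 1]`_i.

(* With indices counted from 0, the rows (columns) 2i-1 and 2i of the usual
   numbering are the even and the odd indices with half i-1. *)
Definition hat (Y : 'M[R]_4) : 'M[R]_8 :=
  \matrix_(k, l)
    let i : 'I_4 := inord k./2 in let j : 'I_4 := inord l./2 in
    if ~~ odd k && ~~ odd l then Y i j else
    if odd k && odd l then hat_sign i * hat_sign j * Y i j else 0.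

(* coord is meaningful only on the span of the (free) family one_vectors; for Y
   in Spin32 the matrix hat Y is invertible and conjugation by it preserves
   this span, so Phi32 is the intended matrix there. *)
Definition Phi32 (Y : 'M[R]_4) : 'M[R]_5 :=
  \matrix_(i, j)
    coord one_vectors i (hat Y *m tnth one_vectors j *m invmx (hat Y)).

Definition I32 : 'M[R]_5 := mx_of_diag 5 [:: 1; 1; 1; -1; -1].

Definition SO32 : set 'M[R]_5 :=
  [set X | X^T *m I32 *m X = I32 /\ \det X = 1].

Definition SOplus32 : set 'M[R]_5 := connected_component SO32 1%:M.

Definition Phi32_preimage (g : 'M[R]_5) : set 'M[R]_4 :=
  Spin32 `&` Phi32 @^-1` [set g].

End Definitions.

(* Main.v *)
Require Import Defs.
From mathcomp Require Import all_boot all_order all_algebra.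
From mathcomp Require Import mxtens ring lra.
From mathcomp Require Import all_classical all_reals all_analysis.

Import Order.TTheory GRing.Theory Num.Theory.
Import numFieldNormedType.Exports.

Local Open Scope classical_set_scope.
Local Open Scope ring_scope.

(* On the two parity classes of indices, hat Y acts as Y and as D Y D with
   D = diag(1, -1, -1, 1), and a one-vector X_i as gamma_i and - D gamma_i D.
   Conjugating X_i by hat Y thus amounts to conjugating the 4x4 matrix gamma_i
   by Y.  The span of the gamma_i consists of the traceless Z such that Z M is
   antisymmetric, a condition preserved by Spin(3,2); hence Phi(Y) = g if and
   only if Y gamma_j = (sum_k g_kj gamma_k) Y for all j.  Two elements of the
   same fibre differ by a matrix commuting with all gamma_i, that is by a scalar,
   which is 1 or -1 because both preserve M.  An element of the fibre over a
   rotation or boost in the plane (p, q) is the usual half-angle rotor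
   c - e s gamma_p gamma_q, with e = gamma_p ^ 2, by the Clifford relations. *)

(** * Connected one-parameter families in SO(3,2) *)

Lemma continuous_mx (R : realType) (T : topologicalType) (m n : nat)
    (f : T -> 'M[R]_(m, n)) :
  (forall i j, continuous (fun x => f x i j)) -> continuous f.
Proof.
move=> fc x A [P nP sPA].
have : \forall y \near x, forall i j, P i j (f y i j).
  apply: filter_forall => i; apply: filter_forall => j.
  exact: (fc i j x (P i j) (nP i j)).
by apply: filterS => y /sPA.
Qed.

(* det (f x) = det (f (x / 2)) ^ 2, and the square of the determinant of an
   isometry is 1: this makes det (f x) = 1 without a continuity argument. *)
Lemma SOplus32_one_parameter (R : realType) (f : R -> 'M[R]_5) :
  (forall i j, continuous (fun x => f x i j)) -> f 0 = 1%:M ->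
  (forall x, (f x)^T *m I32 *m f x = I32) ->
  (forall x, f (x + x) = f x *m f x) ->
  forall x, SOplus32 (f x).
Proof.
move=> fc f0 fI fD x.
have detI : \det (@I32 R) != 0.
  rewrite det_diag; apply/prodf_neq0 => -[[|[|[|[|[|?]]]]] ?] _ //;
  by rewrite mxE /= ?oppr_eq0 oner_neq0.
have det2 y : \det (f y) * \det (f y) = 1.
  have := congr1 determinant (fI y).
  rewrite !det_mulmx det_tr mulrAC -[RHS]mul1r => /mulIf; exact.
have det1 y : \det (f y) = 1.
  by rewrite [y]splitr fD det_mulmx det2.
apply: (@connected_component_max _ _ (range f) 1%:M); last by exists x.
- by exists 0.
- by move=> _ [y _ <-].
- apply: connected_continuous_connected.
    exact/connected_intervalP.
  by apply: continuous_subspaceT; exact: continuous_mx.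
Qed.

(** * Hyperbolic functions *)

Section Hyperbolic.
Context {R : realType}.
Implicit Types x y : R.

Lemma cosh0 : cosh (0 : R) = 1.
Proof. by rewrite /cosh oppr0 expR0; field. Qed.

Lemma sinh0 : sinh (0 : R) = 0.
Proof. by rewrite /sinh oppr0 subrr mul0r. Qed.

Lemma coshD x y : cosh (x + y) = cosh x * cosh y + sinh x * sinh y.
Proof. by rewrite /cosh /sinh opprD !expRD; field. Qed.

Lemma sinhD x y : sinh (x + y) = sinh x * cosh y + cosh x * sinh y.
Proof. by rewrite /cosh /sinh opprD !expRD; field. Qed.

Lemma cosh2Bsinh2 x : cosh x ^+ 2 - sinh x ^+ 2 = 1.
Proof.
transitivity (expR x * expR (- x)); last by rewrite -expRD subrr expR0.
by rewrite /cosh /sinh; field.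
Qed.

Lemma continuous_cosh : continuous (@cosh R).
Proof.
move=> x; apply: cvgMl; apply: cvgD; first exact: continuous_expR.
by apply: (@continuous_comp _ _ _ -%R expR);
  [exact: opp_continuous | exact: continuous_expR].
Qed.

Lemma continuous_sinh : continuous (@sinh R).
Proof.
move=> x; apply: cvgMl; apply: cvgB; first exact: continuous_expR.
by apply: (@continuous_comp _ _ _ -%R expR);
  [exact: opp_continuous | exact: continuous_expR].
Qed.

End Hyperbolic.

(** * Matrices acting in one coordinate plane *)

Section PlaneMatrix.
Context {R : realType} {n : nat} {p q : 'I_n}.
Context (pq : p != q).
Implicit Types (a b c d : R).

Let pqE : (p == q) = false. Proof. exact: negPf. Qed.
Let qpE : (q == p) = false. Proof. by rewrite eq_sym. Qed.

Local Ltac split_index i :=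
  let e := fresh in
  case: (eqVneq i p) => [e|/negPf ?]; [rewrite ?e {e}|
    case: (eqVneq i q) => [e|/negPf ?]; [rewrite ?e {e}|]].
Local Ltac decide_indices :=
  rewrite ?eqxx;
  repeat match goal with h : (_ == _) = false |- _ => progress rewrite ?h end.

(** Here [p] and [q] are ordinals counted from 0, while [plane_mx] counts positions from 1; hence
    the successors. *)
Lemma plane_mxE a b c d i j : plane_mx n p.+1 q.+1 a b c d i j =
  if i == p then (if j == p then a else if j == q then b else 0)
  else if i == q then (if j == p then c else if j == q then d else 0)
  else (i == j)%:R.
Proof.
rewrite mxE !eqSS !(inj_eq val_inj).
by split_index i; split_index j; decide_indices.
Qed.

Lemma mul_plane_mx m a b c d (B : 'M[R]_(n, m)) i j :
  (plane_mx n p.+1 q.+1 a b c d *m B) i j =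
  if i == p then a * B p j + b * B q j
  else if i == q then c * B p j + d * B q j else B i j.
Proof.
rewrite mxE; under eq_bigr do rewrite plane_mxE.
have sumpq u v : \sum_k (if k == p then u else if k == q then v else 0) * B k j
    = u * B p j + v * B q j.
  rewrite (bigD1 p) //= (bigD1 q) ?qpE //= !eqxx ?qpE big1 ?addr0 // => k.
  by case/andP => /negPf-> /negPf->; rewrite mul0r.
case: (i == p); first exact: sumpq.
case: (i == q); first exact: sumpq.
rewrite (bigD1 i) //= eqxx mul1r big1 ?addr0 // => k.
by rewrite eq_sym => /negPf->; rewrite mul0r.
Qed.

Lemma plane_mx1 : plane_mx n p.+1 q.+1 1 0 0 1 = 1%:M :> 'M[R]_n.
Proof.
apply/matrixP => i j; rewrite plane_mxE mxE.
by split_index i; split_index j; decide_indices.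
Qed.

Lemma plane_mxM a b c d a' b' c' d' :
  plane_mx n p.+1 q.+1 a b c d *m plane_mx n p.+1 q.+1 a' b' c' d' =
  plane_mx n p.+1 q.+1 (a * a' + b * c') (a * b' + b * d')
                       (c * a' + d * c') (c * b' + d * d').
Proof.
apply/matrixP => i j; rewrite mul_plane_mx !plane_mxE !eqxx qpE.
by split_index i; split_index j; decide_indices; rewrite // !mulr0 addr0.
Qed.

Lemma tr_plane_mx a b c d :
  (plane_mx n p.+1 q.+1 a b c d)^T = plane_mx n p.+1 q.+1 a c b d.
Proof.
apply/matrixP => i j; rewrite mxE !plane_mxE.
by split_index i; split_index j; decide_indices; rewrite // eq_sym.
Qed.

(** The hypotheses are the (p,p), (p,q) and (q,q) entries of the claimed equation; the (q,p) entry
    follows by symmetry, and outside the plane the matrix is the identity. *)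
Lemma plane_mx_isometry (e : 'rV[R]_n) a b c d :
  e 0 p * a ^+ 2 + e 0 q * c ^+ 2 = e 0 p ->
  e 0 p * a * b + e 0 q * c * d = 0 ->
  e 0 p * b ^+ 2 + e 0 q * d ^+ 2 = e 0 q ->
  (plane_mx n p.+1 q.+1 a b c d)^T *m diag_mx e *m plane_mx n p.+1 q.+1 a b c d
  = diag_mx e.
Proof.
move=> epp epq eqq; have diagE k l (A : 'M[R]_n) :
    (diag_mx e *m A) k l = e 0 k * A k l by rewrite mul_diag_mx mxE.
rewrite tr_plane_mx -mulmxA; apply/matrixP => i j.
rewrite mul_plane_mx !diagE !plane_mxE [diag_mx e i j]mxE.
split_index i; split_index j; decide_indices; rewrite ?mulr1n ?mulr0n ?mulr0 ?addr0 //.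
- by rewrite -[RHS]epp; ring.
- by rewrite -[RHS]epq; ring.
- by rewrite -[RHS]epq; ring.
- by rewrite -[RHS]eqq; ring.
- by rewrite mulr_natr.
Qed.

Lemma continuous_plane_mx (a b c d : R -> R) :
  continuous a -> continuous b -> continuous c -> continuous d ->
  forall i j, continuous
    (fun x => plane_mx n p.+1 q.+1 (a x) (b x) (c x) (d x) i j : R).
Proof.
move=> ac bc cc dc i j; under eq_fun do rewrite plane_mxE.
by do !case: (_ == _) => //; exact: cst_continuous.
Qed.

End PlaneMatrix.

(** * Rotations and boosts lie in the identity component *)

Lemma I32E (R : realType) (p : 'I_5) :
  (\row_j [:: 1; 1; 1; -1; -1]`_j : 'rV[R]_5) 0 p = (-1) ^+ (2 < p)%N.
Proof. by rewrite mxE; case: p => -[|[|[|[|[|?]]]]]. Qed.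

(** The two indices carry the same sign of [I32], so on their plane the form is plus or minus the
    Euclidean one, which rotations preserve. *)
Lemma SOplus32_givens (R : realType) (p q : 'I_5) (t : R) :
  p != q -> (2 < p)%N = (2 < q)%N -> SOplus32 (givens p.+1 q.+1 t).
Proof.
move=> pq epq; apply: (SOplus32_one_parameter _ (givens p.+1 q.+1)) => [||x|x].
- apply: (continuous_plane_mx pq);
    [exact: continuous_cos| |exact: continuous_sin|exact: continuous_cos].
  by move=> x; apply: cvgN; exact: continuous_sin.
- by rewrite /givens cos0 sin0 oppr0 plane_mx1.
- apply: plane_mx_isometry => //; rewrite !I32E epq.
  + by rewrite -mulrDr cos2Dsin2 mulr1.
  + by ring.
  + by rewrite sqrrN -mulrDr addrC cos2Dsin2 mulr1.
- by rewrite /givens plane_mxM // cosD sinD; congr plane_mx; ring.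
Qed.

Lemma SOplus32_hgivens (R : realType) (p q : 'I_5) (t : R) :
  (p <= 2 < q)%N -> SOplus32 (hgivens p.+1 q.+1 t).
Proof.
case/andP => p2 q2; have pq : p != q by apply: contraTneq q2 => <-; rewrite -leqNgt.
apply: (SOplus32_one_parameter _ (hgivens p.+1 q.+1)) => [||x|x].
- by apply: (continuous_plane_mx pq);
    [exact: continuous_cosh|exact: continuous_sinh..|exact: continuous_cosh].
- by rewrite /hgivens cosh0 sinh0 plane_mx1.
- have ch := cosh2Bsinh2 x.
  apply: plane_mx_isometry => //; rewrite !I32E q2 ltnNge p2 /= ?expr1 ?expr0; lra.
- by rewrite /hgivens plane_mxM // coshD sinhD; congr plane_mx; ring.
Qed.

(** * Computation with matrices given by their rows *)

Definition arith01 (R : realType) := (mul0r, mulr0, @mul1r R, @mulr1 R, addr0,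
  @add0r R, @mulN1r R, @mulrN1 R, @opprK R, @oppr0 R).

Ltac mx_entries :=
  apply/matrixP => -[[|[|[|[|[|[|[|[|?]]]]]]]] ?] [[|[|[|[|[|[|[|[|?]]]]]]]] ?] //;
  rewrite ?(mxE, big_ord_recl, big_ord0) /= ?arith01.

(** Turns a matrix equation into an equality of explicit lists, from which all scalar equations come
    by injectivity. The side condition on sizes is boolean, so it is settled by computation. *)
Lemma mx_of_rows_inj (R : realType) m n (a b : seq (seq R)) :
  mx_of_rows m n a = mx_of_rows m n b ->
  [&& size a == m, size b == m, all (fun r => size r == n) a
    & all (fun r => size r == n) b] -> a = b.
Proof.
move=> /matrixP E /and4P[/eqP sa /eqP sb /allP na /allP nb].
apply: (@eq_from_nth _ [::]) => [|k]; rewrite ?sa ?sb // => km.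
have /eqP sak : size (nth [::] a k) == n by apply/na/mem_nth; rewrite sa.
have /eqP sbk : size (nth [::] b k) == n by apply/nb/mem_nth; rewrite sb.
apply: (@eq_from_nth _ 0) => [|l]; rewrite ?sak ?sbk // => ln.
by have := E (Ordinal km) (Ordinal ln); rewrite !mxE.
Qed.

(** With [mkseq] and [foldr] in place of a big sum, the product of explicit matrices reduces to an
    explicit list of rows. *)
Lemma mx_of_rowsM (R : realType) m n p (a b : seq (seq R)) :
  mx_of_rows m n a *m mx_of_rows n p b = mx_of_rows m p
    (mkseq (fun i => mkseq (fun k => foldr (fun j s =>
      (nth [::] a i)`_j * (nth [::] b j)`_k + s) 0 (iota 0 n)) p) m).
Proof.
apply/matrixP => i k; rewrite !mxE !nth_mkseq //.
under eq_bigr do rewrite !mxE.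
rewrite -(big_mkord xpredT (fun j => (nth [::] a i)`_j * (nth [::] b j)`_k)).
by rewrite /index_iota subn0 unlock.
Qed.

Lemma tr_mx_of_rows (R : realType) m n (a : seq (seq R)) :
  (mx_of_rows m n a)^T =
  mx_of_rows n m (mkseq (fun j => mkseq (fun i => (nth [::] a i)`_j) m) n).
Proof. by apply/matrixP => i j; rewrite !mxE !nth_mkseq. Qed.

Lemma opp_mx_of_rows (R : realType) m n (a : seq (seq R)) :
  - mx_of_rows m n a =
  mx_of_rows m n (mkseq (fun i => mkseq (fun j => - (nth [::] a i)`_j) n) m).
Proof. by apply/matrixP => i j; rewrite !mxE !nth_mkseq. Qed.

Definition mx_of_rowsE :=
  (mx_of_rowsM, tr_mx_of_rows, opp_mx_of_rows).

(** * The spin form and the 4x4 gamma matrices *)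

Section Spin.
Context {R : realType}.
Implicit Types (A B Y Z : 'M[R]_4) (g : 'M[R]_5) (w : 'I_5 -> R) (r s : R).

Local Notation M := (@spin_form R : 'M[R]_4).

Lemma spin_formE : M = mx_of_rows 4 4 [:: [:: 0; 0; 0; 1]; [:: 0; 0; -1; 0];
  [:: 0; 1; 0; 0]; [:: -1; 0; 0; 0]].
Proof.
apply/matrixP => i j; rewrite !mxE.
case: (@splitP 2 2 i) => k ik; rewrite !mxE; case: (@splitP 2 2 j) => l jl;
  rewrite !mxE ik jl; case: k {ik} => -[|[|?]] ? //; by case: l {jl} => -[|[|?]].
Qed.

Lemma mx4P A : exists a : nat * nat -> R, A = mx_of_rows 4 4
  [:: [:: a (0, 0)%N; a (0, 1)%N; a (0, 2)%N; a (0, 3)%N];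
      [:: a (1, 0)%N; a (1, 1)%N; a (1, 2)%N; a (1, 3)%N];
      [:: a (2, 0)%N; a (2, 1)%N; a (2, 2)%N; a (2, 3)%N];
      [:: a (3, 0)%N; a (3, 1)%N; a (3, 2)%N; a (3, 3)%N]].
Proof.
exists (fun kl => A (inord kl.1) (inord kl.2)).
by mx_entries; congr (A _ _); apply: val_inj; rewrite /= inordK.
Qed.

(* Reordering the standard basis by the parity of the index makes each
   one-vector block diagonal; gamma i is its block on the indices which are even
   when counted from 0. *)
Definition gamma (i : 'I_5) : 'M[R]_4 := mx_of_rows 4 4 (nth [::]
  [:: [:: [:: 0; 0; 1; 0]; [:: 0; 0; 0; 1]; [:: 1; 0; 0; 0]; [:: 0; 1; 0; 0]];
      [:: [:: 0; 1; 0; 0]; [:: 1; 0; 0; 0]; [:: 0; 0; 0; -1]; [:: 0; 0; -1; 0]];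
      [:: [:: 1; 0; 0; 0]; [:: 0; -1; 0; 0]; [:: 0; 0; -1; 0]; [:: 0; 0; 0; 1]];
      [:: [:: 0; 0; 1; 0]; [:: 0; 0; 0; 1]; [:: -1; 0; 0; 0]; [:: 0; -1; 0; 0]];
      [:: [:: 0; 1; 0; 0]; [:: -1; 0; 0; 0]; [:: 0; 0; 0; -1]; [:: 0; 0; 1; 0]]] i).

(** * Parity blocks: from 8x8 matrices to 4x4 matrices *)

Definition twist A : 'M[R]_4 := \matrix_(i, j) (hat_sign i * hat_sign j * A i j).

(** The even block is [A], the odd block [r] times its conjugate by diag(1,-1,-1,1). The value r = 1
    gives [hat], and r = -1 gives the one-vectors, so a single product rule covers both. *)
Definition hat_lift r A : 'M[R]_(4 * 2) :=
  A *t delta_mx (0 : 'I_2) (0 : 'I_2) + (r *: twist A) *t delta_mx (1 : 'I_2) (1 : 'I_2).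

Lemma hat_signK (i : 'I_4) : hat_sign i * hat_sign i = 1 :> R.
Proof. by case: i => -[|[|[|[|?]]]] ? //; rewrite /hat_sign /=; ring. Qed.

Lemma twistM A B : twist (A *m B) = twist A *m twist B.
Proof.
apply/matrixP => i j; rewrite !mxE mulr_sumr; apply: eq_bigr => k _; rewrite !mxE.
by rewrite -[LHS]mul1r -(hat_signK k); ring.
Qed.

Lemma hat_liftM r s A B : hat_lift r A *m hat_lift s B = hat_lift (r * s) (A *m B).
Proof.
rewrite /hat_lift mulmxDl !mulmxDr !tensmx_mul.
rewrite !mul_delta_mx_cond /= !mulr0n !tensmx0 addr0 add0r.
by rewrite -scalemxAl -scalemxAr scalerA twistM.
Qed.

Lemma hat_lift_sum (I : finType) r (w : I -> R) (F : I -> 'M[R]_4) :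
  hat_lift r (\sum_i w i *: F i) = \sum_i w i *: hat_lift r (F i).
Proof.
apply/matrixP => k l; rewrite summxE !mxE !summxE !(mulr_suml, mulr_sumr) -big_split /=.
by apply: eq_bigr => i _; rewrite !mxE; ring.
Qed.

Lemma hatE A : hat A = hat_lift 1 A.
Proof.
apply/matrixP => k l; rewrite !mxE mul1r.
(* The Kronecker index splits as quotient and remainder by 2, matching the half and the parity used
   in [hat]. *)
have unk (i : 'I_(4 * 2)) : inord i./2 = (mxtens_unindex i).1.
  apply: val_inj; rewrite /= inordK; first exact/esym/divn2.
  by rewrite ltn_half_double; exact: ltn_ord i.
rewrite (unk k) (unk l) -!val_eqE /= !modn2.
by case: (odd k); case: (odd l); rewrite /= ?mulr0 ?mulr1 ?addr0 ?add0r.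
Qed.

Lemma hat_lift1 : hat_lift 1 1%:M = 1%:M.
Proof. by mx_entries; rewrite /hat_sign /= ?arith01. Qed.

(** The factor -1 cancels the sign of the twist, so both parity blocks equal [A]. This serves every
    one-vector but the third, which falls under [hat_lift_inv]. *)
Lemma hat_lift_anti A : twist A = - A -> hat_lift (-1) A = A *t (1%:M : 'M[R]_2).
Proof.
move=> tA; rewrite /hat_lift tA scaleN1r opprK.
apply/matrixP => k l; case: (mxtens_indexP k) => i c; case: (mxtens_indexP l) => j d.
rewrite mxE !tensmxE !mxE -mulrDr; congr (_ * _).
by case: c => -[|[|?]] ? //; case: d => -[|[|?]] ? //=; rewrite ?addr0 ?add0r.
Qed.

Lemma hat_lift_inv A : twist A = A -> hat_lift (-1) A = A *t (@sigma_z R).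
Proof.
move=> tA; rewrite /hat_lift tA scaleN1r.
apply/matrixP => k l; case: (mxtens_indexP k) => i c; case: (mxtens_indexP l) => j d.
rewrite mxE !tensmxE !mxE mulNr -mulrN -mulrDr; congr (_ * _).
by case: c => -[|[|?]] ? //; case: d => -[|[|?]] ? //=;
  rewrite ?mulr0n ?mulr1n ?oppr0 ?addr0 ?add0r.
Qed.

Lemma tensmx1_4 (rows : seq (seq R)) (A := mx_of_rows 2 2 rows) :
  A *t (1%:M : 'M[R]_4) = A *t (1%:M : 'M[R]_2) *t (1%:M : 'M[R]_2) :> 'M[R]_8.
Proof. by mx_entries. Qed.

Lemma twist_gamma i : twist (gamma i) = (if i == 2 :> nat then gamma i else - gamma i).
Proof.
by case: i => -[|[|[|[|[|?]]]]] ? //=; mx_entries; rewrite /hat_sign /= ?arith01.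
Qed.

Lemma one_vectorsE i : tnth one_vectors i = hat_lift (-1) (gamma i).
Proof.
have := twist_gamma i.
case: i => -[|[|[|[|[|?]]]]] ? //= tg; rewrite (tnth_nth 0) /=.
- rewrite hat_lift_anti // tensmx1_4;
  apply: (congr1 (fun A : 'M[R]_4 => A *t (1%:M : 'M[R]_2))).
  by mx_entries.
- rewrite hat_lift_anti //;
  apply: (congr1 (fun A : 'M[R]_4 => A *t (1%:M : 'M[R]_2))).
  by mx_entries.
- rewrite hat_lift_inv //; apply: (congr1 (fun A : 'M[R]_4 => A *t (@sigma_z R))).
  by mx_entries.
- rewrite hat_lift_anti // tensmx1_4;
  apply: (congr1 (fun A : 'M[R]_4 => A *t (1%:M : 'M[R]_2))).
  by mx_entries.
- rewrite hat_lift_anti //;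
  apply: (congr1 (fun A : 'M[R]_4 => A *t (1%:M : 'M[R]_2))).
  by mx_entries.
Qed.

(** * Inverses in Spin(3,2) and the invariant span of the gammas *)

Lemma trmx_spin_form : M^T = - M.
Proof. by rewrite spin_formE !mx_of_rowsE /mkseq /= ?arith01. Qed.

Lemma spin_form2 : M *m M = - 1%:M.
Proof. by rewrite spin_formE !mx_of_rowsE /mkseq /= ?arith01; mx_entries. Qed.

(** Since M has inverse -M, the relation Y^T M Y = M makes this the inverse of Y. *)
Definition spin_inv Y : 'M[R]_4 := - (M *m Y^T *m M).

Lemma spin_mulVmx Y : Spin32 Y -> spin_inv Y *m Y = 1%:M.
Proof.
move=> YM; have {}YM : Y^T *m M *m Y = M := YM.
by rewrite /spin_inv mulNmx -!mulmxA [Y^T *m _]mulmxA YM spin_form2 opprK.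
Qed.

Lemma spin_mulmxV Y : Spin32 Y -> Y *m spin_inv Y = 1%:M.
Proof. by move=> /spin_mulVmx/mulmx1C. Qed.

Lemma gamma_sumE w : \sum_k w k *: gamma k =
  let v0 := w (inord 0) in let v1 := w (inord 1) in
  let v2 := w (inord 2) in let v3 := w (inord 3) in let v4 := w (inord 4) in
  mx_of_rows 4 4 [:: [:: v2; v1 + v4; v0 + v3; 0];
                     [:: v1 - v4; - v2; 0; v0 + v3];
                     [:: v0 - v3; 0; - v2; - v1 - v4];
                     [:: 0; v0 - v3; v4 - v1; v2]].
Proof.
transitivity (\sum_(0 <= k < 5) w (inord k) *: gamma (inord k)).
  by rewrite big_mkord; apply: eq_bigr => k _; rewrite inord_val.
rewrite unlock /= /gamma !inordK //=.
by mx_entries; rewrite // addrC.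
Qed.

Lemma gamma_inj (v w : 'I_5 -> R) :
  \sum_k v k *: gamma k = \sum_k w k *: gamma k -> forall i, v i = w i.
Proof.
move=> + i; rewrite !gamma_sumE /= => /mx_of_rows_inj/(_ isT)[] *.
rewrite -(inord_val i); case: i => -[|[|[|[|[|i]]]]] //= _; lra.
Qed.

(* The antisymmetric 4x4 matrices form a space of dimension 6, in which the trace
   condition cuts out the 5-dimensional span of the gammas. *)
Lemma gammaP Z : \tr Z = 0 -> (Z *m M)^T = - (Z *m M) ->
  exists w, Z = \sum_i w i *: gamma i.
Proof.
have [z ->] := mx4P Z.
rewrite spin_formE !mx_of_rowsE /mkseq /= ?arith01 /mxtrace
  ?(mxE, big_ord_recl, big_ord0) /=.
move=> tr0 /mx_of_rows_inj/(_ isT)[] *.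
(* The witness solves the system read off [gamma_sumE]: v0 + v3 = z02, v0 - v3 = z20, v1 + v4 = z01,
   v1 - v4 = z10, v2 = z00. *)
exists (fun i : 'I_5 => [:: (z (0, 2)%N + z (2, 0)%N) / 2;
  (z (0, 1)%N + z (1, 0)%N) / 2; z (0, 0)%N;
  (z (0, 2)%N - z (2, 0)%N) / 2; (z (0, 1)%N - z (1, 0)%N) / 2]`_i).
rewrite gamma_sumE /= !inordK //=.
congr (mx_of_rows 4 4
  [:: [:: _; _; _; _]; [:: _; _; _; _]; [:: _; _; _; _]; [:: _; _; _; _]]); lra.
Qed.

(** Each gamma is self-adjoint for M. This makes gamma M antisymmetric, and it makes products of two
    distinct gammas skew-adjoint. *)
Lemma gamma_form i : (gamma i : 'M[R]_4)^T *m M = M *m gamma i.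
Proof.
rewrite spin_formE /gamma; case: i => -[|[|[|[|[|?]]]]] ? //=;
by rewrite !mx_of_rowsE /mkseq /= ?arith01.
Qed.

(** Both conditions of [gammaP] survive: the trace is invariant under conjugation, and Z M changes
    by the congruence Y (Z M) Y^T, which keeps antisymmetry. *)
Lemma conj_gamma Y i : Spin32 Y ->
  exists w, Y *m gamma i *m spin_inv Y = \sum_k w k *: gamma k.
Proof.
move=> YS; apply: gammaP.
  rewrite mxtrace_mulC mulmxA spin_mulVmx // mul1mx.
  case: i => -[|[|[|[|[|?]]]]] ? //;
  rewrite /mxtrace ?(mxE, big_ord_recl, big_ord0) /=; ring.
have gM : (gamma i *m M)^T = - (gamma i *m M).
  have gT : (gamma i)^T = - (M *m gamma i *m M).
    by rewrite -gamma_form -mulmxA spin_form2 mulmxN mulmx1 opprK.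
  by rewrite trmx_mul trmx_spin_form gT mulNmx mulmxN opprK !mulmxA
    spin_form2 !mulNmx mul1mx.
have -> : Y *m gamma i *m spin_inv Y *m M = Y *m (gamma i *m M) *m Y^T.
  rewrite /spin_inv mulmxN mulNmx -!mulmxA spin_form2.
  by rewrite !mulmxN opprK mulmx1.
by rewrite 2!trmx_mul trmxK gM mulNmx mulmxN mulmxA.
Qed.

Lemma gamma_centralizer B : (forall i, B *m gamma i = gamma i *m B) -> B = (B 0 0)%:M.
Proof.
have [b ->] := mx4P B => E.
(* These four gammas generate Cl(3,1), which is all of M(4,R), so the resulting linear equations
   leave only scalars. *)
have := (E (inord 0), E (inord 1), E (inord 2), E (inord 3)) => {E}.
rewrite /gamma !inordK //=.
rewrite !mx_of_rowsE /mkseq /= ?arith01 => -[[[E1 E2] E3] E4].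
case/mx_of_rows_inj/(_ isT): E1 => *.
case/mx_of_rows_inj/(_ isT): E2 => *.
case/mx_of_rows_inj/(_ isT): E3 => *.
case/mx_of_rows_inj/(_ isT): E4 => *.
mx_entries; lra.
Qed.

(** * Coordinates of Phi and its fibres *)

Lemma one_vectors_free : free (@one_vectors R).
Proof.
apply/freeP => k; under eq_bigr do rewrite -tnth_nth one_vectorsE.
rewrite -hat_lift_sum => /matrixP E.
apply: (@gamma_inj _ (fun=> 0)).
(* Entries at two even indices recover the relation between the gammas. *)
apply/matrixP => i j; have := E (mxtens_index (i, 0 : 'I_2)) (mxtens_index (j, 0 : 'I_2)).
rewrite mxE !tensmxE !mxE /= mulr1 mulr0 addr0 => ->.
by rewrite big1 ?mxE // => l _; rewrite scale0r.
Qed.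

Lemma Spin32E A : Spin32 A = (A^T *m M *m A = M).
Proof. by []. Qed.

Lemma spin_formZ r A :
  (r *: A)^T *m M *m (r *: A) = r ^+ 2 *: (A^T *m M *m A).
Proof. by rewrite [(_ *: _)^T]linearZ /= -!scalemxAl -scalemxAr scalerA. Qed.

(** Written as an intertwining relation, the action involves no inverse and is linear in the entries
    of Y once its image is fixed. *)
Lemma Phi32_gamma Y i : Spin32 Y ->
  Y *m gamma i = (\sum_k Phi32 Y k i *: gamma k) *m Y.
Proof.
move=> YS; have [w Yw] := conj_gamma Y i YS.
have YV : hat Y *m hat_lift 1 (spin_inv Y) = 1%:M.
  by rewrite hatE hat_liftM mulr1 spin_mulmxV // hat_lift1.
have YU : hat Y \in unitmx by case/mulmx1_unit: YV.
have YinvE : invmx (hat Y) = hat_lift 1 (spin_inv Y).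
  by rewrite -[RHS](mulKmx YU) YV mulmx1.
have PhiE k : Phi32 Y k i = w k.
  rewrite mxE YinvE one_vectorsE hatE !hat_liftM mul1r mulr1 Yw hat_lift_sum.
  under eq_bigr do rewrite -one_vectorsE (tnth_nth 0).
  exact/coord_sum_free/one_vectors_free.
under eq_bigr do rewrite PhiE.
by rewrite -Yw -mulmxA spin_mulVmx // mulmx1.
Qed.

Lemma Phi32_eq Y g : Spin32 Y ->
  (forall i, Y *m gamma i = (\sum_k g k i *: gamma k) *m Y) -> Phi32 Y = g.
Proof.
move=> YS Yg; apply/matrixP => k i; move: k; apply: gamma_inj.
rewrite -[LHS]mulmx1 -[RHS]mulmx1 -(spin_mulmxV _ YS) !mulmxA.
by rewrite -Phi32_gamma // Yg.
Qed.

Lemma Phi32_preimageE g A : Spin32 A ->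
  (forall i, A *m gamma i = (\sum_k g k i *: gamma k) *m A) ->
  Phi32_preimage g = [set A; - A].
Proof.
move=> AS Ag; apply/seteqP; split => [Y [YS /= Yg] | Y].
  have Bgamma i : spin_inv A *m Y *m gamma i = gamma i *m (spin_inv A *m Y).
    rewrite -mulmxA Phi32_gamma // Yg -[in LHS](mul1mx Y) -(spin_mulmxV _ AS).
    by rewrite -[A *m _ *m _]mulmxA [X in _ *m X]mulmxA -Ag !mulmxA spin_mulVmx // mul1mx.
  have := gamma_centralizer _ Bgamma; set l := (X in X%:M) => Bl.
  have YE : Y = l *: A.
    by rewrite -[Y]mul1mx -(spin_mulmxV _ AS) -mulmxA Bl mul_mx_scalar.
  have /eqP : l ^+ 2 = 1.
    move: YS; rewrite Spin32E YE spin_formZ AS spin_formE.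
    (* The (0,3) entry of M is 1, so l^2 M = M gives l^2 = 1. *)
    by move/matrixP/(_ 0 (inord 3)); rewrite !mxE /= inordK //= mulr1.
  rewrite sqrf_eq1 YE => /orP[]/eqP->; rewrite ?scale1r ?scaleN1r; [by left|by right].
case=> ->; split=> //=; first exact: Phi32_eq.
  by rewrite Spin32E -scaleN1r spin_formZ sqrrN expr1n scale1r.
apply: Phi32_eq => [|i]; last by rewrite mulNmx mulmxN Ag.
by rewrite Spin32E -scaleN1r spin_formZ sqrrN expr1n scale1r.
Qed.

(** * Clifford relations and half-angle rotors *)

Definition gamma_sign (i : 'I_5) : R := (-1) ^+ (2 < i)%N.

(** The signs are the diagonal entries of [I32]; with [gamma_anticomm] these are the relations of
    Cl(3,2). *)
Lemma gamma_sqr i : gamma i *m gamma i = (gamma_sign i)%:M.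
Proof.
have -> : (gamma_sign i)%:M = mx_of_rows 4 4 [:: [:: gamma_sign i; 0; 0; 0];
    [:: 0; gamma_sign i; 0; 0]; [:: 0; 0; gamma_sign i; 0]; [:: 0; 0; 0; gamma_sign i]].
  by mx_entries.
rewrite /gamma_sign /gamma; case: i => -[|[|[|[|[|?]]]]] ? //=;
by rewrite ?(expr0, expr1) !mx_of_rowsE /mkseq /= ?arith01.
Qed.

Lemma gamma_anticomm i j :
  i != j -> gamma i *m gamma j = - (gamma j *m gamma i) :> 'M[R]_4.
Proof.
rewrite -val_eqE /gamma.
by case: i => -[|[|[|[|[|?]]]]] ? //; case: j => -[|[|[|[|[|?]]]]] ? //= _;
rewrite !mx_of_rowsE /mkseq /= ?arith01.
Qed.

Section Bivector.
Context {p q : 'I_5} (pq : p != q) (c s : R).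

Let A : 'M[R]_4 := c%:M + s *: (gamma p *m gamma q).

(** Equal signs give square -1, the case of rotations; opposite signs give +1, the case of
    boosts. *)
Lemma bivector_sqr : gamma p *m gamma q *m (gamma p *m gamma q)
  = - (gamma_sign p * gamma_sign q)%:M :> 'M[R]_4.
Proof.
rewrite mulmxA -[_ *m gamma p]mulmxA (gamma_anticomm q p) 1?eq_sym // mulmxN.
rewrite mulNmx mulmxA gamma_sqr -mulmxA gamma_sqr.
by rewrite -scalar_mxM.
Qed.

(** With N the bivector, skew-adjointness for M reduces the claim to (c - s N)(c + s N) = 1, and N^2
    is a scalar. *)
Lemma Spin32_bivector : c ^+ 2 + gamma_sign p * gamma_sign q * s ^+ 2 = 1 -> Spin32 A.
Proof.
move=> cs; rewrite Spin32E.
have NM : (gamma p *m gamma q)^T *m M = - (M *m (gamma p *m gamma q)).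
  rewrite trmx_mul -mulmxA gamma_form mulmxA gamma_form -mulmxA.
  by rewrite (gamma_anticomm q p) 1?eq_sym // mulmxN.
have -> : A^T *m M = M *m (c%:M - s *: (gamma p *m gamma q)).
  rewrite /A linearD linearZ /= tr_scalar_mx mulmxDl -scalemxAl NM.
  by rewrite mulmxBr -scalemxAr mul_scalar_mx mul_mx_scalar scalerN.
rewrite -mulmxA -[RHS]mulmx1; congr (_ *m _).
transitivity ((c ^+ 2 + gamma_sign p * gamma_sign q * s ^+ 2) *: 1%:M : 'M[R]_4);
  last by rewrite cs scale1r.
rewrite mulmxDr !mulmxBl !mul_scalar_mx !mul_mx_scalar.
rewrite -!scalemxAl -!scalemxAr bivector_sqr -[c%:M]scalemx1 -[(_ * _)%:M]scalemx1.
move: (gamma p *m gamma q) => N; apply/matrixP => i j; rewrite !mxE.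
by move: ((i == j)%:R : R) (N i j) => d x; ring.
Qed.

(** The hypotheses compare coefficients of gamma_p and gamma_q, the first two for j = p and the last
    two for j = q. Any other gamma_j anticommutes with both factors of the bivector, hence commutes
    with [A]. *)
Lemma bivector_gamma (a b a' b' : R) :
  c = a * c - gamma_sign q * s * a' ->
  - gamma_sign p * s = gamma_sign p * s * a + a' * c ->
  c = b' * c + gamma_sign p * s * b ->
  gamma_sign q * s = b * c - gamma_sign q * s * b' ->
  forall j, A *m gamma j = (\sum_k plane_mx 5 p.+1 q.+1 a b a' b' k j *: gamma k) *m A.
Proof.
have qp : q != p by rewrite eq_sym.
move=> h1 h2 h3 h4 j.
have sumE (F : 'I_5 -> R) : \sum_k F k *: gamma k =
    F p *: gamma p + F q *: gamma q + \sum_(k | (k != p) && (k != q)) F k *: gamma k.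
  by rewrite (bigD1 p) //= (bigD1 q) //= addrA.
have NP : gamma p *m gamma q *m gamma p = - gamma_sign p *: gamma q.
  rewrite -mulmxA (gamma_anticomm q p) // mulmxN mulmxA gamma_sqr mul_scalar_mx.
  by rewrite scaleNr.
have PN : gamma p *m (gamma p *m gamma q) = gamma_sign p *: gamma q.
  by rewrite mulmxA gamma_sqr mul_scalar_mx.
have NQ : gamma p *m gamma q *m gamma q = gamma_sign q *: gamma p.
  by rewrite -mulmxA gamma_sqr mul_mx_scalar.
have QN : gamma q *m (gamma p *m gamma q) = - gamma_sign q *: gamma p.
  by rewrite mulmxA (gamma_anticomm q p) // mulNmx NQ scaleNr.
rewrite sumE !plane_mxE // !eqxx (negPf qp).
have [->|jp] := eqVneq j p; last have [->|jq] := eqVneq j q.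
- rewrite big1 ?addr0; last first.
    by move=> k /andP[kp kq]; rewrite plane_mxE // (negPf kp) (negPf kq) scale0r.
  rewrite /A !mulmxDl !mulmxDr !mul_mx_scalar mul_scalar_mx -!scalemxAl -!scalemxAr.
  rewrite NP PN QN; move: (gamma p) (gamma q) => P Q.
  apply/matrixP => k l; rewrite !mxE; move: (P k l) (Q k l) => x y.
  (* The goal is x times [h1] plus y times [h2]. *)
  have := congr1 ( *%R^~ x) h1; have := congr1 ( *%R^~ y) h2.
  move=> /=; lra.
- rewrite big1 ?addr0; last first.
    by move=> k /andP[kp kq]; rewrite plane_mxE // (negPf kp) (negPf kq) scale0r.
  rewrite /A !mulmxDl !mulmxDr !mul_mx_scalar mul_scalar_mx -!scalemxAl -!scalemxAr.
  rewrite NQ PN QN; move: (gamma p) (gamma q) => P Q.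
  apply/matrixP => k l; rewrite !mxE; move: (P k l) (Q k l) => x y.
  have := congr1 ( *%R^~ y) h3; have := congr1 ( *%R^~ x) h4.
  move=> /=; lra.
rewrite !scale0r !add0r (bigD1 j) /= ?jp ?jq // plane_mxE // (negPf jp) (negPf jq) eqxx.
rewrite scale1r big1 => [|k /andP[/andP[kp kq] kj]]; last first.
  by rewrite plane_mxE // (negPf kp) (negPf kq) (negPf kj) scale0r.
rewrite addr0 /A mulmxDl mulmxDr mul_scalar_mx mul_mx_scalar -scalemxAl -scalemxAr.
congr (_ + _ *: _); rewrite -mulmxA (gamma_anticomm q j) 1?eq_sym // mulmxN mulmxA.
by rewrite (gamma_anticomm p j) 1?eq_sym // mulNmx opprK mulmxA.
Qed.

End Bivector.
End Spin.

(** * Half-angle identities and the fibres over Givens matrices *)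

Lemma half_angle (R : realType) (t : R) (c := cos (t / 2)) (s := sin (t / 2)) :
  [/\ c ^+ 2 + s ^+ 2 = 1, cos t * c + sin t * s = c & sin t * c - cos t * s = s].
Proof.
have cs : c ^+ 2 + s ^+ 2 = 1 by exact: cos2Dsin2.
have cosE : cos t = c * c - s * s by rewrite [in LHS](splitr t) cosD.
have sinE : sin t = s * c + c * s by rewrite [in LHS](splitr t) sinD.
split=> //; rewrite cosE sinE.
- by rewrite -[RHS]mulr1 -cs; ring.
- by rewrite -[RHS]mulr1 -cs; ring.
Qed.

(** The last two identities say that the boost by b carries (c, -s) to (c, s), just as the rotation
    by t does in [half_angle]; they supply the coefficient conditions of [bivector_gamma]. *)
Lemma half_argument (R : realType) (b : R) (c := cosh (b / 2)) (s := sinh (b / 2)) :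
  [/\ c ^+ 2 - s ^+ 2 = 1, cosh b * c - sinh b * s = c & sinh b * c - cosh b * s = s].
Proof.
have cs : c ^+ 2 - s ^+ 2 = 1 by exact: cosh2Bsinh2.
have coshE : cosh b = c * c + s * s by rewrite [in LHS](splitr b) coshD.
have sinhE : sinh b = s * c + c * s by rewrite [in LHS](splitr b) sinhD.
split=> //; rewrite coshE sinhE.
- by rewrite -[RHS]mulr1 -cs; ring.
- by rewrite -[RHS]mulr1 -cs; ring.
Qed.

Lemma Phi32_preimage_givens (R : realType) (p q : 'I_5) (t : R)
    (A : 'M[R]_4 := (cos (t / 2))%:M -
      (gamma_sign p * sin (t / 2)) *: (gamma p *m gamma q)) :
  p != q -> (2 < p)%N = (2 < q)%N ->
  Phi32_preimage (givens p.+1 q.+1 t) = [set A; - A].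
Proof.
move=> pq epq; have [cs ct st] := half_angle R t; rewrite /A -scaleNr.
apply: Phi32_preimageE; [apply: Spin32_bivector => //|apply: bivector_gamma => //];
  rewrite /gamma_sign -?epq; case: (2 < p)%N; rewrite ?expr0 ?expr1; lra.
Qed.

(** Here gamma_p squares to 1, so the rotor carries no sign factor. *)
Lemma Phi32_preimage_hgivens (R : realType) (p q : 'I_5) (b : R)
    (A : 'M[R]_4 := (cosh (b / 2))%:M - sinh (b / 2) *: (gamma p *m gamma q)) :
  (p <= 2 < q)%N -> Phi32_preimage (hgivens p.+1 q.+1 b) = [set A; - A].
Proof.
case/andP => p2 q2; have pq : p != q by apply: contraTneq q2 => <-; rewrite -leqNgt.
have [cs ct st] := half_argument R b; rewrite /A -scaleNr.
apply: Phi32_preimageE; [apply: Spin32_bivector => //|apply: bivector_gamma => //];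
  rewrite /gamma_sign ?q2 1?ltnNge ?p2 /= ?expr0 ?expr1; lra.
Qed.

Theorem theorem30 (R : realType) (t b : R) (ht : 0 <= t <= 2 * pi) :
  let c := cos (t / 2) in
  let s := sin (t / 2) in
  let ch := cosh (b / 2) in
  let sh := sinh (b / 2) in
  let pm (A : 'M[R]_4) : set 'M[R]_4 := [set A; - A] in
  [/\ SOplus32 (givens 1 2 t), SOplus32 (givens 1 3 t),
      SOplus32 (givens 2 3 t) & SOplus32 (givens 4 5 t)] /\
  [/\ SOplus32 (hgivens 1 4 b), SOplus32 (hgivens 2 5 b)
    & SOplus32 (hgivens 3 4 b)] /\
  [/\ Phi32_preimage (givens 1 2 t) =
        pm (mx_of_rows 4 4 [:: [:: c; 0; 0; s];
                               [:: 0; c; s; 0];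
                               [:: 0; - s; c; 0];
                               [:: - s; 0; 0; c]]),
      Phi32_preimage (givens 1 3 t) =
        pm (mx_of_rows 4 4 [:: [:: c; 0; s; 0];
                               [:: 0; c; 0; - s];
                               [:: - s; 0; c; 0];
                               [:: 0; s; 0; c]]),
      Phi32_preimage (givens 2 3 t) =
        pm (mx_of_rows 4 4 [:: [:: c; s; 0; 0];
                               [:: - s; c; 0; 0];
                               [:: 0; 0; c; s];
                               [:: 0; 0; - s; c]])
    & Phi32_preimage (givens 4 5 t) =
        pm (mx_of_rows 4 4 [:: [:: c; 0; 0; - s];
                               [:: 0; c; s; 0];
                               [:: 0; - s; c; 0];
                               [:: s; 0; 0; c]])] /\
  [/\ Phi32_preimage (hgivens 1 4 b) =
        pm (mx_of_diag 4 [:: expR (b / 2); expR (b / 2);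
                             expR (- b / 2); expR (- b / 2)]),
      Phi32_preimage (hgivens 2 5 b) =
        pm (mx_of_diag 4 [:: expR (b / 2); expR (- b / 2);
                             expR (b / 2); expR (- b / 2)])
    & Phi32_preimage (hgivens 3 4 b) =
        pm (mx_of_rows 4 4 [:: [:: ch; 0; - sh; 0];
                               [:: 0; ch; 0; sh];
                               [:: - sh; 0; ch; 0];
                               [:: 0; sh; 0; ch]])].
Proof.
move=> c s ch sh pm.
(* For the planes (1,4) and (2,5) the bivector is diagonal with entries 1 and -1, so the rotor has
   diagonal entries ch + sh and ch - sh. *)
have ce : ch + sh = expR (b / 2) by rewrite /ch /sh /cosh /sinh; field.
have cf : ch - sh = expR (- b / 2) by rewrite mulNr /ch /sh /cosh /sinh; field.
(* Concrete ordinals, counted from 0, make the successors compute to the positions in the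
   statement. *)
pose o k (k5 : (k < 5)%N) := Ordinal k5.
pose o0 := o 0%N isT; pose o1 := o 1%N isT; pose o2 := o 2%N isT.
pose o3 := o 3%N isT; pose o4 := o 4%N isT.
have givensE (p q : 'I_5) (A : 'M[R]_4) : p != q -> (2 < p)%N = (2 < q)%N ->
    A = c%:M - (gamma_sign p * s) *: (gamma p *m gamma q) ->
    Phi32_preimage (givens p.+1 q.+1 t) = pm A.
  by move=> pq epq ->; exact: Phi32_preimage_givens.
have hgivensE (p q : 'I_5) (A : 'M[R]_4) : (p <= 2 < q)%N ->
    A = ch%:M - sh *: (gamma p *m gamma q) ->
    Phi32_preimage (hgivens p.+1 q.+1 b) = pm A.
  by move=> pq ->; exact: Phi32_preimage_hgivens.
split; first by split; [exact: (SOplus32_givens _ o0 o1)|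
  exact: (SOplus32_givens _ o0 o2)|exact: (SOplus32_givens _ o1 o2)|
  exact: (SOplus32_givens _ o3 o4)].
split; first by split; [exact: (SOplus32_hgivens _ o0 o3)|
  exact: (SOplus32_hgivens _ o1 o4)|exact: (SOplus32_hgivens _ o2 o3)].
split; split;
  [apply: (givensE o0 o1)|apply: (givensE o0 o2)|apply: (givensE o1 o2)|apply: (givensE o3 o4)
  |apply: (hgivensE o0 o3)|apply: (hgivensE o1 o4)|apply: (hgivensE o2 o3)] => //;
  rewrite /gamma /gamma_sign mx_of_rowsE /mkseq /= ?arith01 ?(expr0, expr1, mul1r, mulN1r).
all: clear -ce cf; mx_entries; rewrite ?mulr1n ?mulr0n; lra.
Qed.
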